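(* Let $T\sim\{X_n\}_{n=1}^\infty$ be a random weighted shift with $\operatorname{essran}X_1=[0,1]$. If $A$ is a deterministic unilateral weighted shift, then $A\lhd T$ almost surely if and only if $\|A\|\le 1$.
   Context: $\mathcal H$ is a complex separable infinite-dimensional Hilbert space with orthonormal basis $\{e_n\}_{n=1}^\infty$. $\{X_n\}_{n=1}^\infty$ are nonnegative, bounded, i.i.d. random variables on a probability space $(\Omega,\mathcal F,\mathbb P)$. Writing $T\sim\{X_n\}$ means that $T=T(\omega)$ is the random unilateral weighted shift $T(\omega)e_n=X_n(\omega)e_{n+1}$, $n\ge1$. $\operatorname{essran}X_1$ is the essential range of $X_1$ (closed support of its law). A (deterministic) unilateral weighted shift $A$ acts by $Af_i=a_if_{i+1}$, $i\ge 1$, on some orthonormal basis $\{f_i\}_{i\ge1}$ of a Hilbert space, with bounded nonnegative weights $\{a_i\}$. For Hilbert space operators $A,B$ (bounded, linear), $A\lhd B$ means $\|p(A,A^* )\|\le\|p(B,B^* )\|$ for all complex polynomials $p(x,y)$ in two free (noncommuting) variables (constant terms allowed). *)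

(* Defs.v *)
From HB Require Import structures.
From mathcomp Require Import all_boot all_order all_algebra.
From mathcomp Require Import finmap complex.
From mathcomp Require Import all_classical all_reals all_analysis.
(* The notations of monalg clash with those of mathcomp-analysis. *)
From mathcomp Require Import -(notations) monalg.

Set Implicit Arguments.
Unset Strict Implicit.
Unset Printing Implicit Defensive.

Import Order.TTheory GRing.Theory Num.Theory.
Import numFieldNormedType.Exports.

Local Open Scope classical_set_scope.
Local Open Scope complex_scope.
Local Open Scope ring_scope.

(* The inner product is linear in its first argument. *)
Record hilbertSpace (R : realType) := HilbertSpace {
  hilbert_sort :> completeNormedModType R[i];
  inner : {dot hilbert_sort for (@Num.conj R[i])};
  hilbert_normE : forall x : hilbert_sort, `|x| ^+ 2 = inner x x }.

Section Operators.
Context {R : realType} {H : hilbertSpace R}.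
Implicit Types (A B : H -> H) (e : nat -> H).

(* Sequences indexed by n >= 1 in the literature are indexed from 0. *)
Definition orthonormal_basis e : Prop :=
  (forall m n, inner H (e m) (e n) = (m == n)%:R) /\
  closure [set x | exists (n : nat) (c : 'I_n -> R[i]),
             x = \sum_(i < n) c i *: e i] = setT.

Definition bounded_operator A : Prop :=
  (forall (c : R[i]) (x y : H), A (c *: x + y) = c *: A x + A y) /\
  (exists M : R[i], forall x, `|A x| <= M * `|x|).

(* The norm of a module over R[i] takes its (real) values in R[i]. *)
Definition opnorm A : \bar R :=
  ereal_sup [set (complex.Re `|A x|)%:E | x in [set x : H | `|x| <= 1]].

(* For bounded linear A the vector z exists (Riesz) and is unique, so that
   the default value 0 is not used. *)
Definition adjoint A : H -> H :=
  fun y => xget 0 [set z | forall x, inner H (A x) y = inner H x z].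

Lemma adjoint_eq A B :
  (forall x y, inner H (A x) y = inner H x (B y)) -> adjoint A = B.
Proof.
move=> AB; apply/funext => y; rewrite /adjoint.
case: xgetP => [z _ zP | /(_ (B y))]; last by case=> x; exact: AB.
apply/eqP; rewrite -subr_eq0; apply/eqP.
suff : `|z - B y| ^+ 2 = 0 by move=> /eqP; rewrite sqrf_eq0 normr_eq0 => /eqP.
by rewrite hilbert_normE linearBr /= -zP -AB subrr.
Qed.

(* The word i_1 ... i_k in the letters x = 0 and y = 1, evaluated at
   x = A and y = B, is the composite of the corresponding operators. *)
Definition word_eval A B (w : fmonom 'I_2) : H -> H :=
  foldr (fun (i : 'I_2) (S : H -> H) => (if i == ord0 then A else B) \o S) id
    (fmonom_val w).

Definition ncpoly_eval (p : malg (fmonom 'I_2) R[i]) A B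
  : H -> H :=
  fun x => \sum_(w <- msupp p) mcoeff w p *: word_eval A B w x.

Definition weighted_shift e (a : nat -> R) A : Prop :=
  [/\ orthonormal_basis e,
      forall i, 0 <= a i,
      exists M, forall i, a i <= M,
      bounded_operator A &
      forall i, A (e i) = (a i)%:C *: e i.+1].

End Operators.

(* A <| B, for operators on possibly different Hilbert spaces; the elements of
   malg (fmonom 'I_2) R[i] are the complex polynomials in two free variables. *)
Definition dominated {R : realType} {K H : hilbertSpace R}
    (A : K -> K) (B : H -> H) : Prop :=
  forall p : malg (fmonom 'I_2) R[i],
    (opnorm (ncpoly_eval p A (adjoint A))
       <= opnorm (ncpoly_eval p B (adjoint B)))%E.

Section Randomness.
Context {R : realType} {d : measure_display} {Omega : measurableType d}.
Variable P : probability Omega R.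
Implicit Types X : nat -> {RV P >-> R}.

Definition mutually_independent X : Prop :=
  forall (J : seq nat) (B : nat -> set R), uniq J ->
    (forall j, measurable (B j)) ->
    P (\bigcap_(j in [set` J]) (X j @^-1` B j)) =
      (\prod_(j <- J) P (X j @^-1` B j))%E.

Definition identically_distributed X : Prop :=
  forall n (B : set R), measurable B ->
    distribution P (X n) B = distribution P (X 0%N) B.

Definition essran (Y : {RV P >-> R}) : set R :=
  [set x | forall U, open U -> U x -> (0 < distribution P Y U)%E].

(* On a null set of w the operator T w may be any bounded operator. *)
Definition random_weighted_shift {H : hilbertSpace R} (e : nat -> H) X
    (T : Omega -> H -> H) : Prop :=
  [/\ orthonormal_basis e,
      forall w, bounded_operator (T w) &
      {ae P, forall w, forall n, T w (e n) = (X n w)%:C *: e n.+1}].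

End Randomness.

(* Main.v *)
Require Import Defs.
From HB Require Import structures.
From mathcomp Require Import all_boot all_order all_algebra.
From mathcomp Require Import finmap complex.
From mathcomp Require Import all_classical all_reals all_analysis.
From mathcomp Require Import measurable_realfun.
From mathcomp Require Import -(notations) monalg.

Import Order.TTheory GRing.Theory Num.Theory.
Import numFieldNormedType.Exports.

Set Implicit Arguments.
Unset Strict Implicit.
Unset Printing Implicit Defensive.

Local Open Scope classical_set_scope.
Local Open Scope complex_scope.
Local Open Scope ring_scope.

(** The norm of a weighted shift is the supremum of its weights. Almost surely
    all the weights of [T] lie in the essential range, so [T] is a contraction,
    and domination tested on the polynomial [x] gives the bound on the norm of [A].

    Conversely, suppose that [A] is a contraction, so that its weights [a i] lie
    in the unit interval, the essential range. The finite pattern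
    [0, a 0, ..., a n] is then matched within any given error by a fixed block
    of the random weights with positive probability; disjoint blocks being
    independent, almost surely it is matched somewhere ([prob_never_hit],
    [ae_pattern]). This yields positions [k m] at which [T] looks more and more
    like [A]: the isometry sending [f i] to [e (k m + i).+1] almost intertwines
    [A] with [T], because the weights almost agree, and the adjoint of [A] with
    that of [T], because moreover the weight at [k m], in front of the block, is
    almost 0, as if the basis started there. Hence it almost intertwines every
    polynomial in [A] and its adjoint with the same polynomial in [T] and its
    adjoint ([approx_ncpoly]). The norm of the former at a finite combination of
    the [f i] of norm 1 is therefore a limit of numbers bounded by the norm of
    the latter, and density concludes ([dominated_of_copies]).

    Polynomials in the adjoints have to be bounded for the density argument, so
    adjoints of shifts must exist on the whole space ([adjoint_total]). *)

(** * Inner products, bounded operators and density *)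

Section Hilbert.
Context {R : realType} {H : hilbertSpace R}.
Implicit Types (x y z : H) (c : R[i]) (e : nat -> H) (u v : nat -> H).

Lemma innerC x y : inner H x y = Num.conj (inner H y x).
Proof. by have := hermC (inner H) x y; rewrite /= expr0 mul1r. Qed.

Lemma innerDl x y z : inner H (x + y) z = inner H x z + inner H y z.
Proof. exact: linearDl. Qed.
Lemma innerDr x y z : inner H x (y + z) = inner H x y + inner H x z.
Proof. exact: linearDr. Qed.
Lemma innerZl c x y : inner H (c *: x) y = c * inner H x y.
Proof. exact: linearZl_LR. Qed.
Lemma innerZr c x y : inner H x (c *: y) = Num.conj c * inner H x y.
Proof. exact: linearZr_LR. Qed.
Lemma inner0l y : inner H 0 y = 0. Proof. exact: linear0l. Qed.
Lemma inner0r y : inner H y 0 = 0. Proof. exact: linear0r. Qed.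
Lemma innerBl x y z : inner H (x - y) z = inner H x z - inner H y z.
Proof. exact: linearBl. Qed.
Lemma innerBr x y z : inner H x (y - z) = inner H x y - inner H x z.
Proof. exact: linearBr. Qed.

Lemma pythagoras x y : inner H x y = 0 ->
  `|x + y| ^+ 2 = `|x| ^+ 2 + `|y| ^+ 2.
Proof.
move=> xy; rewrite !hilbert_normE innerDl !innerDr xy (innerC y x) xy.
by rewrite conjC0 addr0 add0r.
Qed.

Lemma inner_eq0 z : (forall x, inner H x z = 0) -> z = 0.
Proof.
move=> /(_ z)/eqP.
by rewrite -hilbert_normE sqrf_eq0 normr_eq0 => /eqP.
Qed.

(** Split [x] into its projection on [y], with coefficient [c], and a remainder
    orthogonal to it, and drop the norm of the remainder. *)
Lemma cauchy_schwarz x y : `|inner H x y| <= `|x| * `|y|.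
Proof.
have [->|y0] := eqVneq y 0; first by rewrite inner0r !normr0 mulr0.
have yy0 : `|y| ^+ 2 != 0 by rewrite sqrf_eq0 normr_eq0.
pose c := inner H x y / `|y| ^+ 2.
have xy : inner H (x - c *: y) (c *: y) = 0.
  rewrite innerZr innerBl innerZl -hilbert_normE /c divfK//.
  by rewrite subrr mulr0.
rewrite -(@ler_pXn2r _ 2) ?nnegrE ?mulr_ge0// exprMn.
rewrite -[x in leRHS](subrK (c *: y)) pythagoras// normrZ mulrDl.
rewrite -[leLHS]add0r; apply: lerD; first by rewrite mulr_ge0 ?exprn_ge0.
rewrite /c normrM normfV normrX normr_id -exprMn.
by rewrite expr2 invfM !mulrA !mulfVK ?normr_eq0.
Qed.

Lemma norm_complexR (r : R) : `|r%:C| = `|r|%:C.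
Proof. by rewrite normc_def /= expr0n addr0 sqrtr_sqr. Qed.

Lemma conj_complexR (r : R) : Num.conj r%:C = r%:C.
Proof. by apply/conj_Creal; rewrite complex_real. Qed.

Lemma normE_Re (W : normedZmodType R[i]) (x : W) : (complex.Re `|x|)%:C = `|x|.
Proof. by rewrite RRe_real. Qed.

Lemma orthonormal_norm e n : orthonormal_basis e -> `|e n| = 1.
Proof.
move=> [he _]; apply/eqP.
by rewrite -(@eqrXn2 _ 2)// hilbert_normE he eqxx expr1n.
Qed.

Lemma bounded_operatorB (B : H -> H) x y :
  bounded_operator B -> B (x - y) = B x - B y.
Proof.
case=> linB _; have := linB (-1) y x.
by rewrite !scaleN1r addrC => ->; rewrite addrC.
Qed.

Lemma closure_ball_ex (S : set H) x (eps : R[i]) :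
  closure S = setT -> 0 < eps -> exists2 y, S y & `|x - y| < eps.
Proof.
move=> SH e0; have : closure S x by rewrite SH.
move=> /(_ (ball x eps) (nbhsx_ballx x _ e0)) [y [Sy xy]].
by exists y => //; move: xy; rewrite -ball_normE.
Qed.

(** What is known of a shift is known on finite combinations of basis vectors;
    this carries estimates, and with [M = 0] identities, to the whole space. The
    target [W] covers operators as well as scalar functionals. The constant [C]
    only provides continuity, while [M] is the sharp bound. *)
Lemma norm_le_dense (W : normedZmodType R[i]) (S : set H) (phi : H -> W)
    (C M : R[i]) : closure S = setT ->
  (forall x y, phi (x - y) = phi x - phi y) ->
  (forall x, `|phi x| <= C * `|x|) -> 0 <= M ->
  (forall x, S x -> `|phi x| <= M * `|x|) -> forall x, `|phi x| <= M * `|x|.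
Proof.
move=> SH phiB phiC M0 phiM x; apply/ler_addgt0Pr => e e0.
pose c := `|C| + M + 1.
have c0 : 0 < c by rewrite ltr_wpDl// addr_ge0.
have [y Sy xy] := closure_ball_ex x SH (divr_gt0 e0 c0).
rewrite -[phi x](subrK (phi y)) -phiB.
apply: (le_trans (ler_normD _ _)).
have phixy : `|phi (x - y)| <= `|C| * `|x - y|.
  rewrite (le_trans (phiC _))//.
  have [->|xy0] := eqVneq (x - y) 0; first by rewrite normr0 !mulr0.
  have Cge0 : 0 <= C.
    by rewrite -(@pmulr_lge0 _ `|x - y|) ?normr_gt0// (le_trans _ (phiC _)).
  by rewrite ger0_norm.
have yx : `|y| <= `|x| + `|x - y|.
  by rewrite -{1}[y](subKr x) (le_trans (ler_normB _ _)).
rewrite (le_trans (lerD phixy (le_trans (phiM _ Sy) (ler_wpM2l M0 yx))))//.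
rewrite mulrDr addrCA -mulrDl lerD2l.
rewrite (@le_trans _ _ (c * `|x - y|))//.
  by rewrite ler_wpM2r// lerDl.
by rewrite -ler_pdivlMl// mulrC ltW.
Qed.

Definition spanned (e : nat -> H) : set H :=
  [set x | exists (n : nat) (c : 'I_n -> R[i]), x = \sum_(i < n) c i *: e i].

Lemma bounded_operator0 (B : H -> H) : bounded_operator B -> B 0 = 0.
Proof. by move=> hB; have := bounded_operatorB 0 0 hB; rewrite !subrr. Qed.

Lemma bounded_operatorD (B : H -> H) x y :
  bounded_operator B -> B (x + y) = B x + B y.
Proof. by case=> linB _; have := linB 1 x y; rewrite !scale1r. Qed.

Lemma bounded_operatorZ (B : H -> H) c x :
  bounded_operator B -> B (c *: x) = c *: B x.
Proof.
move=> hB; have [linB _] := hB; have := linB c x 0.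
by rewrite (bounded_operator0 hB) !addr0.
Qed.

Lemma bounded_operator_sum (B : H -> H) n (u : 'I_n -> H) :
  bounded_operator B ->
  B (\sum_(i < n) u i) = \sum_(i < n) B (u i).
Proof.
move=> hB; elim: n u => [|n IH] u; first by rewrite !big_ord0 bounded_operator0.
by rewrite !big_ord_recr /= bounded_operatorD// IH.
Qed.

Lemma bounded_operator_norm (B : H -> H) : bounded_operator B ->
  exists2 M : R[i], 0 < M & forall x, `|B x| <= M * `|x|.
Proof.
case=> _ [M hM]; exists (`|M| + 1); first by rewrite ltr_wpDl.
move=> x; have [->|x0] := eqVneq x 0.
  by rewrite (le_trans (hM _))// normr0 !mulr0.
have M0 : 0 <= M.
  by rewrite -(@pmulr_lge0 _ `|x|) ?normr_gt0// (le_trans _ (hM _)).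
by rewrite (le_trans (hM _))// ler_wpM2r// ger0_norm// lerDl.
Qed.

Lemma inner_eq_basis e (B : H -> H) y z : orthonormal_basis e ->
  bounded_operator B -> (forall m, inner H (B (e m)) y = inner H (e m) z) ->
  forall x, inner H (B x) y = inner H x z.
Proof.
move=> [_ de] hB hyz x; have [M M0 hM] := bounded_operator_norm hB.
pose phi (x1 : H) := inner H (B x1) y - inner H x1 z.
suff : `|phi x| <= 0 * `|x|.
  by rewrite mul0r normr_le0 subr_eq0 => /eqP.
apply: (@norm_le_dense _ (spanned e) phi (M * `|y| + `|z|)) => //.
- move=> u v; rewrite /phi bounded_operatorB// !innerBl.
  by rewrite !opprD !opprK addrACA.
- move=> u; rewrite /phi (le_trans (ler_normB _ _))// mulrDl lerD//.
    rewrite (le_trans (cauchy_schwarz _ _))// mulrAC ler_wpM2r//.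
  by rewrite mulrC cauchy_schwarz.
- move=> _ [n [c ->]]; rewrite mul0r normr_le0 subr_eq0; apply/eqP.
  rewrite bounded_operator_sum//.
  elim: n c => [|n IH] c; first by rewrite !big_ord0 !inner0l.
  by rewrite !big_ord_recr /= !innerDl IH bounded_operatorZ// !innerZl hyz.
Qed.

Lemma spannedP e : orthonormal_basis e -> closure (spanned e) = setT.
Proof. by case. Qed.

(** * Adjoints of weighted shifts *)

Lemma adjointP (B : H -> H) y :
  (exists z, forall x, inner H (B x) y = inner H x z) ->
  forall x, inner H (B x) y = inner H x (adjoint B y).
Proof. by case=> z hz; rewrite /adjoint; case: xgetP => [//|/(_ z)]. Qed.

Lemma adjoint_uniq (B : H -> H) y z :
  (forall x, inner H (B x) y = inner H x z) -> adjoint B y = z.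
Proof.
move=> hz; apply/eqP; rewrite -subr_eq0; apply/eqP/inner_eq0 => x.
rewrite innerBr -hz adjointP ?subrr//; by exists z.
Qed.

(** Riesz representation is avoided: the vectors at which the adjoint exists
    form a closed subspace, which is everything as soon as it contains an
    orthonormal basis. *)
Definition adjointable (B : H -> H) y :=
  exists z, forall x, inner H (B x) y = inner H x z.

Lemma adjointable_comb (B : H -> H) c y y' :
  adjointable B y -> adjointable B y' -> adjointable B (c *: y + y').
Proof.
move=> [z hz] [z' hz']; exists (c *: z + z') => x.
by rewrite !innerDr !innerZr hz hz'.
Qed.

(** With [z] the value of the adjoint at [y], the square of the norm of [z] is
    the inner product of [B z] and [y]. *)
Lemma adjointable_norm (B : H -> H) (M : R[i]) y :
  (forall x, `|B x| <= M * `|x|) -> adjointable B y ->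
  `|adjoint B y| <= M * `|y|.
Proof.
move=> hM hy; set z := adjoint B y.
have [->|z0] := eqVneq z 0.
  by rewrite normr0 (le_trans (normr_ge0 (B y)))// hM.
rewrite -(@ler_pM2r _ `|z|) ?normr_gt0// -expr2 hilbert_normE.
rewrite /z -(adjointP hy) -/z.
have := le_trans (cauchy_schwarz (B z) y) (ler_wpM2r (normr_ge0 y) (hM z)).
rewrite adjointP// -/z -hilbert_normE ger0_norm ?exprn_ge0//.
by rewrite mulrAC.
Qed.

Lemma adjointB (B : H -> H) y y' : adjointable B y -> adjointable B y' ->
  adjoint B (y - y') = adjoint B y - adjoint B y'.
Proof.
by move=> hy hy'; apply: adjoint_uniq => x; rewrite !innerBr -!adjointP.
Qed.

(** On the vectors where it exists the adjoint is Lipschitz, so its values along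
    adjointable vectors tending to [y] form a Cauchy filter; completeness gives
    a limit, and it represents the functional attached to [y]. *)
Lemma adjointable_closed (B : H -> H) y : bounded_operator B ->
  closure (adjointable B) y -> adjointable B y.
Proof.
move=> hB cly; have [M M0 hM] := bounded_operator_norm hB.
pose F := adjoint B @ within (adjointable B) (nbhs y).
have WF : ProperFilter (within (adjointable B) (nbhs y)).
  exact: within_nbhs_proper.
have FF : ProperFilter F by apply: fmap_proper_filter.
have near_ball (e : R[i]) : 0 < e ->
    \forall d \near within (adjointable B) (nbhs y), `|y - d| < e.
  move=> e0; apply: cvg_within; have := nbhsx_ballx y _ e0.
  by rewrite -ball_normE.
have near_adj :
    \forall d \near within (adjointable B) (nbhs y), adjointable B d.
  by apply: withinT.
have Fcvg : cvg F.
  apply/cauchy_cvgP/cauchy_exP => e e0.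
  have e2 : 0 < e / M / 2 by rewrite !divr_gt0.
  have [d [hd yd]] : exists d, adjointable B d /\ `|y - d| < e / M / 2.
    have /filter_ex[d hd] : \forall d \near within (adjointable B) (nbhs y),
        adjointable B d /\ `|y - d| < e / M / 2.
      by apply: filterI => //; exact: near_ball.
    by exists d.
  exists (adjoint B d).
  rewrite /F /= /fmap /=.
  near=> d'.
  rewrite -ball_normE /= -adjointB//; last by near: d'.
  have hd' : adjointable B (d - d').
    rewrite addrC -scaleN1r; apply: adjointable_comb => //.
    by near: d'.
  rewrite (le_lt_trans (adjointable_norm hM hd'))//.
  rewrite -ltr_pdivlMl// mulrC.
  have -> : d - d' = (y - d') - (y - d) by rewrite opprB [RHS]addrC addrA subrK.
  rewrite (le_lt_trans (ler_normB _ _))//.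
  (* Both [d] and [d'] lie within [e / M / 2] of [y]. *)
  rewrite [ltRHS]splitr.
  by rewrite ltrD//; near: d'; exact: near_ball.
exists (lim F) => x.
apply/eqP; rewrite -subr_eq0 -normr_le0; apply/ler_addgt0Pr => e e0.
rewrite add0r; pose c := `|B x| + `|x| + 1.
have c0 : 0 < c by rewrite ltr_wpDl// addr_ge0.
have /filter_ex[d [[hd yd] gd]] :
    \forall d \near within (adjointable B) (nbhs y),
    (adjointable B d /\ `|y - d| < e / c) /\ `|lim F - adjoint B d| < e / c.
  apply: filterI.
    by apply: filterI => //; exact: near_ball (divr_gt0 e0 c0).
  by have /cvgr_dist_lt := Fcvg; apply; exact: divr_gt0.
have -> : inner H (B x) y - inner H x (lim F) =
    inner H (B x) (y - d) - inner H x (lim F - adjoint B d).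
  by rewrite !innerBr (adjointP hd) opprB addrA subrK.
rewrite (le_trans (ler_normB _ _))//.
rewrite (@le_trans _ _ ((`|B x| + `|x|) * (e / c)))//.
  by rewrite mulrDl lerD// (le_trans (cauchy_schwarz _ _))// ler_wpM2l// ltW.
by rewrite mulrCA ger_pMr// ler_pdivrMr// mul1r lerDl.
Unshelve. all: by end_near. Qed.

Lemma adjoint_total e (B : H -> H) :
  orthonormal_basis e -> bounded_operator B ->
  (forall n, adjointable B (e n)) -> forall y, adjointable B y.
Proof.
move=> be hB he y; apply: adjointable_closed => //.
suff : closure (spanned e) `<=` closure (adjointable B).
  by move=> h; apply: h; rewrite spannedP.
apply: closure_subset => _ [n [c ->]].
elim: n c => [|n IH] c.
  by rewrite big_ord0; exists 0 => x; rewrite !inner0r.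
by rewrite big_ord_recr /= addrC; apply: adjointable_comb.
Qed.

Lemma adjoint_bounded (B : H -> H) : bounded_operator B ->
  (forall y, adjointable B y) -> bounded_operator (adjoint B).
Proof.
move=> hB he; split; last first.
  have [M M0 hM] := bounded_operator_norm hB.
  by exists M => y; exact: adjointable_norm.
move=> c y y'; apply: adjoint_uniq => x.
by rewrite !innerDr !innerZr (adjointP (he y)) (adjointP (he y')).
Qed.

(** The adjoint of a shift is the backward shift; the first basis vector, which
    no basis vector is mapped to, is killed by it. *)
Lemma shift_adjointable e (b : nat -> R) (B : H -> H) : orthonormal_basis e ->
  bounded_operator B -> (forall n, B (e n) = (b n)%:C *: e n.+1) ->
  (forall x, inner H (B x) (e 0%N) = inner H x 0) /\
  (forall n x, inner H (B x) (e n.+1) = inner H x ((b n)%:C *: e n)).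
Proof.
move=> be hB Be; have [on _] := be.
split=> [x|n x]; apply: (inner_eq_basis be hB) => m.
  by rewrite Be innerZl on mulr0 inner0r.
rewrite Be innerZl innerZr !on eqSS conj_complexR.
by case: eqVneq => [->|]; rewrite ?mulr0.
Qed.

Lemma shift_adjoint_total e (b : nat -> R) (B : H -> H) : orthonormal_basis e ->
  bounded_operator B -> (forall n, B (e n) = (b n)%:C *: e n.+1) ->
  forall y, adjointable B y.
Proof.
move=> be hB Be; have [B0 BS] := shift_adjointable be hB Be.
apply: (adjoint_total be hB) => -[|n]; first by exists 0.
by exists ((b n)%:C *: e n).
Qed.

(** * Operator norms and polynomials in two operators *)

Lemma opnorm_leP (B : H -> H) (m : R) : bounded_operator B -> 0 <= m ->
  (opnorm B <= m%:E)%E <-> (forall x, `|B x| <= m%:C * `|x|).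
Proof.
move=> hB m0; split=> [hm x|hm].
  have [->|x0] := eqVneq x 0.
    by rewrite bounded_operator0// !normr0 mulr0.
  have hu : `| `|x|^-1 *: x| <= 1.
    by rewrite normrZ normfV normr_id mulVf// normr_eq0.
  have : ((complex.Re `|B (`|x|^-1 *: x)|)%:E <= m%:E)%E.
    by apply: le_trans hm; apply: ereal_sup_ubound; exists (`|x|^-1 *: x).
  rewrite lee_fin -lecR normE_Re bounded_operatorZ// normrZ normfV normr_id.
  by rewrite ler_pdivrMl ?normr_gt0// mulrC.
apply: ge_ereal_sup => _ [x x1 <-]; rewrite lee_fin -lecR normE_Re.
by rewrite (le_trans (hm x))// ler_piMr// ler0c.
Qed.

Lemma opnorm_ge0 (B : H -> H) : (0 <= opnorm B)%E.
Proof.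
apply: (@le_trans _ _ (complex.Re `|B 0|)%:E).
  by rewrite lee_fin -ler0c normE_Re.
by apply: ereal_sup_ubound; exists 0 => //=; rewrite normr0.
Qed.

Lemma bounded_id : bounded_operator (@id H).
Proof. by split=> //; exists 1 => x; rewrite mul1r. Qed.

Lemma bounded_comp (B C : H -> H) :
  bounded_operator B -> bounded_operator C -> bounded_operator (B \o C).
Proof.
move=> hB hC; split=> [c x y|] /=.
  by case: hC => -> _; case: hB => -> _.
have [M M0 hM] := bounded_operator_norm hB.
have [N N0 hN] := bounded_operator_norm hC.
exists (M * N) => x; rewrite (le_trans (hM _))// -mulrA.
by rewrite ler_wpM2l// ltW.
Qed.

Lemma bounded_lincomb (I : Type) (s : seq I) (c : I -> R[i]) (B : I -> H -> H) :
  (forall i, bounded_operator (B i)) ->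
  bounded_operator (fun x => \sum_(i <- s) c i *: B i x).
Proof.
move=> hB; elim: s => [|i s [lin [M hM]]].
  split=> [d x y|]; first by rewrite !big_nil scaler0 addr0.
  by exists 0 => x; rewrite big_nil normr0 mul0r.
split=> [d x y|].
  rewrite !big_cons lin (bounded_operatorD _ _ (hB i)).
  rewrite (bounded_operatorZ _ _ (hB i)).
  by rewrite !scalerDr addrACA !scalerA mulrC.
have [N N0 hN] := bounded_operator_norm (hB i).
exists (`|c i| * N + M) => x; rewrite big_cons (le_trans (ler_normD _ _))//.
by rewrite mulrDl lerD// normrZ -mulrA ler_wpM2l.
Qed.

Lemma bounded_word (B C : H -> H) w :
  bounded_operator B -> bounded_operator C ->
  bounded_operator (word_eval B C w).
Proof.
move=> hB hC; rewrite /word_eval; elim: (fmonom_val w) => [|i s IH] /=.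
  exact: bounded_id.
by case: ifP => _; exact: bounded_comp.
Qed.

Lemma bounded_ncpoly (B C : H -> H) p :
  bounded_operator B -> bounded_operator C ->
  bounded_operator (ncpoly_eval p B C).
Proof. by move=> hB hC; apply: bounded_lincomb => w; exact: bounded_word. Qed.

(** * Null sequences of vectors *)

Definition null_seq (u : nat -> H) := u @ \oo --> (0 : H).

Lemma null_seqD u v : null_seq u -> null_seq v -> null_seq (fun m => u m + v m).
Proof.
by move=> hu hv; rewrite /null_seq -[X in _ --> X](addr0 0); exact: cvgD.
Qed.

Lemma null_seqP u : null_seq u <->
  forall eps, 0 < eps -> \forall m \near \oo, `|u m| < eps.
Proof. exact: cvgr0Pnorm_lt. Qed.

Lemma null_seq_bounded (B : H -> H) u : bounded_operator B ->
  null_seq u -> null_seq (fun m => B (u m)).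
Proof.
move=> hB /null_seqP hu; apply/null_seqP => eps e0.
have [M M0 hM] := bounded_operator_norm hB.
have := hu _ (divr_gt0 e0 M0); apply: filterS => m um.
by rewrite (le_lt_trans (hM _))// -ltr_pdivlMl// mulrC.
Qed.

Lemma null_seqZ (r : nat -> R) u : r @ \oo --> (0 : R) ->
  (forall m, `|u m| = 1) -> null_seq (fun m => (r m)%:C *: u m).
Proof.
move=> /cvgr0Pnorm_lt hr u1; apply/null_seqP => eps e0.
have eE : eps = (complex.Re eps)%:C by rewrite RRe_real// ger0_real// ltW.
have := hr (complex.Re eps); rewrite -ltcR -eE => /(_ e0).
by apply: filterS => m rm; rewrite normrZ u1 mulr1 norm_complexR eE ltcR.
Qed.

End Hilbert.

(** * Copying vectors along approximate occurrences of the weights *)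

Section Transfer.
Context {R : realType} {K H : hilbertSpace R}.
Variables (f : nat -> K) (e : nat -> H) (a b : nat -> R).
Variables (A : K -> K) (B : H -> H) (k : nat -> nat).
Hypothesis basis_f : orthonormal_basis f.
Hypothesis basis_e : orthonormal_basis e.
Hypothesis bounded_A : bounded_operator A.
Hypothesis bounded_B : bounded_operator B.
Hypothesis shiftA : forall n, A (f n) = (a n)%:C *: f n.+1.
Hypothesis shiftB : forall n, B (e n) = (b n)%:C *: e n.+1.
(* The small weight at [k m] makes the copy of [f 0], which sits at [(k m).+1],
   almost killed by the adjoint of [B], as [f 0] is by the adjoint of [A]. *)
Hypothesis weights_before : (fun m => b (k m)) @ \oo --> (0 : R).
Hypothesis weights_after :
  forall i, (fun m => b (k m + i).+1 - a i) @ \oo --> (0 : R).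

(** [copy x u] says that [u m] is the image of the finite combination [x] under
    the isometry sending [f i] to [e (k m + i).+1]. A relation, rather than a
    function of [x], spares the choice of coordinates for [x]. *)
Inductive copy : K -> (nat -> H) -> Prop :=
| copy_zero : copy 0 (fun=> 0)
| copy_cons c i x u : copy x u ->
    copy (c *: f i + x) (fun m => c *: e (k m + i).+1 + u m).

Lemma copy_comb c x u y v : copy x u -> copy y v ->
  copy (c *: x + y) (fun m => c *: u m + v m).
Proof.
move=> xu yv; elim: xu => [|d i x' u' _ IH].
  rewrite scaler0 add0r; under eq_fun do rewrite scaler0 add0r.
  exact: yv.
rewrite scalerDr scalerA -addrA.
under eq_fun do rewrite scalerDr scalerA -addrA.
exact: copy_cons.
Qed.

Lemma copy_norm x u : copy x u -> forall m, `|u m| = `|x|.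
Proof.
have [onf _] := basis_f; have [one _] := basis_e.
move=> xu m; apply/eqP; rewrite -(@eqrXn2 _ 2)// !hilbert_normE; apply/eqP.
suff inner_eq y v : copy y v -> inner H (u m) (v m) = inner K x y.
  exact: inner_eq.
elim=> [|d j y' v' _ IHv]; first by rewrite !inner0r.
rewrite !innerDr !innerZr IHv; congr (_ * _ + _).
elim: xu => [|c i x' u' _ IHu]; first by rewrite !inner0l.
by rewrite !innerDl !innerZl IHu one onf eqSS eqn_add2l.
Qed.

Lemma copy_spanned x : spanned f x -> exists u, copy x u.
Proof.
move=> [n [c ->]]; elim: n c => [|n IH] c.
  by rewrite big_ord0; exists (fun=> 0); exact: copy_zero.
have [u hu] := IH (fun i => c (widen_ord (leqnSn n) i)).
rewrite big_ord_recr /= addrC.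
by exists (fun m => c ord_max *: e (k m + n).+1 + u m); exact: copy_cons.
Qed.

(** Copies up to a null sequence. Unlike [copy], this relation is stable under
    the shifts and their adjoints, whose weights agree only in the limit. *)
Definition approx x u := exists2 v, copy x v & null_seq (fun m => u m - v m).

Lemma copy_approx x u : copy x u -> approx x u.
Proof.
move=> xu; exists u => //; apply/null_seqP => eps e0.
by apply: nearW => m; rewrite subrr normr0.
Qed.

Lemma approx_comb c x u y v : approx x u -> approx y v ->
  approx (c *: x + y) (fun m => c *: u m + v m).
Proof.
move=> [u' xu' hu] [v' yv' hv]; exists (fun m => c *: u' m + v' m).
  exact: copy_comb.
have hc : bounded_operator (fun z : H => c *: z).
  split=> [d z z'|]; first by rewrite scalerDr !scalerA mulrC.
  by exists `|c| => z; rewrite normrZ.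
have := null_seqD (null_seq_bounded hc hu) hv.
by under eq_fun do rewrite scalerBr addrACA -opprD.
Qed.

(** Boundedness of [D] keeps the error null, and linearity reduces the
    comparison of [C] with [D] to basis vectors. *)
Lemma approx_operator (C : K -> K) (D : H -> H) :
  bounded_operator C -> bounded_operator D ->
  (forall i, approx (C (f i)) (fun m => D (e (k m + i).+1))) ->
  forall x u, approx x u -> approx (C x) (fun m => D (u m)).
Proof.
move=> hC hD CD x u [v xv uv].
have [w xw vw] : approx (C x) (fun m => D (v m)).
  elim: xv => [|c i x' u' _ IH].
    rewrite bounded_operator0//; under eq_fun do rewrite bounded_operator0//.
    exact: copy_approx copy_zero.
  rewrite bounded_operatorD// bounded_operatorZ//.
  under eq_fun do rewrite bounded_operatorD// bounded_operatorZ//.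
  exact: approx_comb.
exists w => //; have := null_seqD (null_seq_bounded hD uv) vw.
by under eq_fun do rewrite (bounded_operatorB _ _ hD) addrA subrK.
Qed.

Lemma approx_shift x u : approx x u -> approx (A x) (fun m => B (u m)).
Proof.
apply: approx_operator => // i.
exists (fun m => (a i)%:C *: e (k m + i.+1).+1).
  rewrite shiftA -[X in copy X]addr0.
  have := copy_cons (a i)%:C i.+1 copy_zero.
  by under eq_fun do rewrite addr0.
under eq_fun do rewrite shiftB addnS -scalerBl -rmorphB.
by apply: null_seqZ => [|m]; [exact: weights_after|exact: orthonormal_norm].
Qed.

Lemma approx_adjoint x u :
  approx x u -> approx (adjoint A x) (fun m => adjoint B (u m)).
Proof.
have adjA := shift_adjoint_total basis_f bounded_A shiftA.
have adjB := shift_adjoint_total basis_e bounded_B shiftB.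
have [A0 AS] := shift_adjointable basis_f bounded_A shiftA.
have [B0 BS] := shift_adjointable basis_e bounded_B shiftB.
apply: approx_operator => [||[|i]]; try exact: adjoint_bounded.
- rewrite (adjoint_uniq A0); exists (fun=> 0); first exact: copy_zero.
  under eq_fun do rewrite subr0 addn0 (adjoint_uniq (BS _)).
  by apply: null_seqZ => [|m]; [exact: weights_before|exact: orthonormal_norm].
- rewrite (adjoint_uniq (AS i)); exists (fun m => (a i)%:C *: e (k m + i).+1).
    rewrite -[X in copy X]addr0.
    have := copy_cons (a i)%:C i copy_zero.
    by under eq_fun do rewrite addr0.
  under eq_fun do rewrite addnS (adjoint_uniq (BS _)) -scalerBl -rmorphB.
  by apply: null_seqZ => [|m]; [exact: weights_after|exact: orthonormal_norm].
Qed.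

Lemma approx_ncpoly p x u : approx x u ->
  approx (ncpoly_eval p A (adjoint A) x)
         (fun m => ncpoly_eval p B (adjoint B) (u m)).
Proof.
move=> xu; rewrite /ncpoly_eval; elim: (enum_fset (msupp p)) => [|w s IH].
  rewrite big_nil; under eq_fun do rewrite big_nil.
  exact: copy_approx copy_zero.
rewrite big_cons; under [X in approx _ X]eq_fun do rewrite big_cons.
apply: approx_comb => //; rewrite /word_eval.
elim: (fmonom_val w) => [//|i l IHl] /=.
by case: ifP => _; [exact: approx_shift IHl|exact: approx_adjoint IHl].
Qed.

(** If [u] copies [x], then the polynomial in [B] applied to [u m] is, up to a
    null sequence, a copy of the polynomial in [A] applied to [x]; since copies
    are isometric, the bound for [B] passes to [A] on finite combinations, hence
    everywhere. *)
Lemma dominated_of_copies : dominated A B.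
Proof.
move=> p.
have hA : bounded_operator (ncpoly_eval p A (adjoint A)).
  apply: bounded_ncpoly => //; apply: adjoint_bounded => //.
  exact: shift_adjoint_total shiftA.
have hB : bounded_operator (ncpoly_eval p B (adjoint B)).
  apply: bounded_ncpoly => //; apply: adjoint_bounded => //.
  exact: shift_adjoint_total shiftB.
have := opnorm_ge0 (ncpoly_eval p B (adjoint B)).
case Em : (opnorm (ncpoly_eval p B (adjoint B))) => [m| |];
  [|by move=> _; exact: leey|by []].
rewrite lee_fin => m0; apply/opnorm_leP => //.
have [C C0 hC] := bounded_operator_norm hA.
apply: (@norm_le_dense _ _ _ (spanned f) _ C) => //.
- exact: spannedP.
- by move=> x y; exact: bounded_operatorB.
- by rewrite ler0c.
move=> x /copy_spanned[u xu].
have [v xv /null_seqP uv] := approx_ncpoly p (copy_approx xu).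
apply/ler_addgt0Pr => eps eps0.
have /filter_ex[n hn] := uv _ eps0.
rewrite -(copy_norm xv n) -(copy_norm xu n).
rewrite -[v n](subKr (ncpoly_eval p B (adjoint B) (u n))).
rewrite (le_trans (ler_normB _ _))// lerD//; last exact: ltW.
suff /(opnorm_leP hB m0) : (opnorm (ncpoly_eval p B (adjoint B)) <= m%:E)%E.
  by apply.
by rewrite Em.
Qed.

End Transfer.

(** * A Borel-Cantelli argument on disjoint blocks *)

Section Patterns.
Context {R : realType} {d : measure_display} {Omega : measurableType d}.
Variables (P : probability Omega R) (X : nat -> {RV P >-> R}).
Hypothesis X_indep : mutually_independent X.
Hypothesis X_ident : identically_distributed X.
Variables (L : nat) (S : nat -> set R).
Hypothesis measurable_S : forall i, measurable (S i).

(** The test set at index [j] depends only on the position of [j] in its block,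
    of length [L]. With one fixed test per index, joint events of several blocks
    are again events of the form [hit J], which is what the independence
    hypothesis speaks about. *)
Definition hit (J : seq nat) : set Omega :=
  \bigcap_(j in [set` J]) (X j @^-1` S (j %% L)).

Definition block n := iota (n * L) L.

Definition miss n : set Omega := \big[setI/setT]_(j < n) ~` hit (block j).

Definition hit_prob : R := \prod_(i < L) fine (distribution P (X 0%N) (S i)).

Lemma measurable_hit J : measurable (hit J).
Proof.
apply: bigcap_measurableType => j _.
by rewrite -[X in measurable X]setTI; exact: measurable_funP.
Qed.

Lemma measurable_miss n : measurable (miss n).
Proof.
by apply: bigsetI_measurable => j _; apply: measurableC; exact: measurable_hit.
Qed.

Lemma hit_cat J J' : hit (J ++ J') = hit J `&` hit J'.
Proof.
rewrite /hit -bigcap_setU; congr (\bigcap_(j in _) _).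
by apply/seteqP; split=> j /=; rewrite mem_cat => /orP.
Qed.

Lemma block_cat n J : uniq J -> all (leq (n.+1 * L)) J ->
  uniq (block n ++ J) /\ all (leq (n * L)) (block n ++ J).
Proof.
move=> uJ hJ; split.
  rewrite cat_uniq iota_uniq uJ andbT /=; apply/hasPn => j /(allP hJ).
  by rewrite mem_iota -mulSnr => h; rewrite ltnNge h andbF.
rewrite all_cat; apply/andP; split.
  by apply/allP => j; rewrite mem_iota => /andP[].
by apply: sub_all hJ => j; apply: leq_trans; rewrite leq_mul2r leqnSn orbT.
Qed.

Lemma prob_hit_block n J : uniq J -> all (leq (n.+1 * L)) J ->
  P (hit (block n ++ J)) = (hit_prob%:E * P (hit J))%E.
Proof.
move=> uJ hJ.
have [uniq_nJ _] := block_cat uJ hJ.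
have mS j : measurable (S (j %% L)) by [].
rewrite /hit (X_indep uniq_nJ mS) big_cat/= -(X_indep uJ mS); congr (_ * _)%E.
rewrite /hit_prob /block -[(n * L)%N]addn0 iotaDl big_map.
rewrite -prodEFin.
rewrite -(big_mkord xpredT (fun i => (fine (distribution P (X 0%N) (S i)))%:E)).
rewrite /index_iota subn0 big_seq [RHS]big_seq; apply: eq_bigr => i.
rewrite mem_iota add0n => /andP[_ iL].
rewrite modnMDl modn_small// fineK ?fin_num_measure//.
exact: (X_ident (n * L + i)).
Qed.

(** The extra event [hit J], over indices beyond the first [n] blocks, is what
    makes the induction go through: it absorbs the next block when its
    complement is written as a difference. *)
Lemma prob_miss n J : uniq J -> all (leq (n * L)) J ->
  P (miss n `&` hit J) = (((1 - hit_prob) ^+ n)%:E * P (hit J))%E.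
Proof.
elim: n J => [|n IH] J uJ hJ.
  by rewrite /miss big_ord0 setTI expr0 mul1e.
have [unJ hnJ] := block_cat uJ hJ.
have hJ' : all (leq (n * L)) J by move: hnJ; rewrite all_cat => /andP[].
have -> : miss n.+1 `&` hit J =
    (miss n `&` hit J) `\` (miss n `&` hit (block n ++ J)).
  rewrite /miss big_ord_recr /= hit_cat; apply/seteqP; split=> w /=.
    by move=> [[mw bw] jw]; split => // -[_ []].
  by move=> [[mw jw] bw]; split => //; split=> // hw; apply: bw.
have -> : P ((miss n `&` hit J) `\` (miss n `&` hit (block n ++ J))) =
    (P (miss n `&` hit J) -
     P ((miss n `&` hit J) `&` (miss n `&` hit (block n ++ J))))%E.
  have mI J' : measurable (miss n `&` hit J').
    by apply: measurableI; [exact: measurable_miss|exact: measurable_hit].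
  by apply: measureD => //; rewrite -ge0_fin_numE// fin_num_measure.
have -> : (miss n `&` hit J) `&` (miss n `&` hit (block n ++ J)) =
    miss n `&` hit (block n ++ J).
  by rewrite hit_cat; apply/seteqP; split=> w /= [? []] // [? ?]; do !split.
rewrite !IH// prob_hit_block//.
have : P (hit J) \is a fin_num.
  by rewrite fin_num_measure//; exact: measurable_hit.
move=> /fineK <-; rewrite -!EFinM -EFinB; congr _%:E.
by rewrite exprSr mulrBr mulr1 mulrBl !mulrA.
Qed.

Lemma hit_nil : hit [::] = setT.
Proof. by apply/seteqP; split. Qed.

(** The probability of missing every block is at most that of missing the first
    [n], a geometric sequence of ratio less than 1. *)
Lemma prob_never_hit : (0 < hit_prob)%R -> P (\bigcap_n ~` hit (block n)) = 0%E.
Proof.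
move=> hp0; set N := \bigcap_n _.
have mN : measurable N.
  by apply: bigcapT_measurable => n; apply: measurableC; exact: measurable_hit.
have N_le n : (P N <= ((1 - hit_prob) ^+ n)%:E)%E.
  have := @prob_miss n [::] isT isT.
  rewrite hit_nil setIT probability_setT mule1 => <-.
  apply: le_measure; rewrite ?inE//; first exact: measurable_miss.
  rewrite /miss -(bigcap_mkord n (fun j => ~` hit (block j))).
  by move=> w Nw j _; exact: Nw.
have hp1 : hit_prob <= 1.
  have := @prob_hit_block 0 [::] isT isT.
  rewrite hit_nil probability_setT mule1 -lee_fin => <-.
  by apply: probability_le1; exact: measurable_hit.
have lim0 : (1 - hit_prob) ^+ n @[n --> \oo] --> (0 : R).
  by apply: cvg_expr; rewrite ger0_norm ?subr_ge0// gtrBl.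
have PN : P N \is a fin_num by rewrite fin_num_measure.
apply/eqP; rewrite eq_le measure_ge0 andbT -(fineK PN) lee_fin.
apply: (cvgr_to_ge lim0); apply: nearW => n.
by rewrite -lee_fin fineK.
Qed.

End Patterns.

(** * Almost sure properties of the random weights *)

Section RandomWeights.
Context {R : realType} {d : measure_display} {Omega : measurableType d}.
Variables (P : probability Omega R) (X : nat -> {RV P >-> R}).
Hypothesis X_indep : mutually_independent X.
Hypothesis X_ident : identically_distributed X.

Lemma ae_pattern (t : nat -> R) (n : nat) (eps : R) :
  (forall i, essran (X 0%N) (t i)) -> 0 < eps ->
  {ae P, forall w, exists k, forall i, (i <= n)%N ->
    `|X (k + i)%N w - t i| < eps}.
Proof.
move=> ht eps0; pose S i : set R := ball (t i) eps.
have mS i : measurable (S i) by rewrite /S ball_itv; exact: measurable_itv.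
have P_S i : (0 < distribution P (X 0%N) (S i))%E.
  by apply: (ht i); [exact: ball_open|exact: ballxx].
exists (\bigcap_j ~` hit X n.+1 S (block n.+1 j)); split.
- by apply: bigcapT_measurable => j; apply: measurableC; exact: measurable_hit.
- apply: prob_never_hit => //; apply: prodr_gt0 => i _.
  by rewrite fine_gt0// P_S ltey_eq fin_num_measure.
move=> w nw j _ hw; apply: nw; exists (j * n.+1)%N => i ilen.
have := hw (j * n.+1 + i)%N.
rewrite /= mem_iota leq_addr ltn_add2l ltnS => /(_ ilen).
by rewrite modnMDl modn_small ?ltnS// /S -ball_normE /= distrC.
Qed.

Lemma ae_forall_countable (T : countType) (Q : T -> Omega -> Prop) :
  (forall q, {ae P, forall w, Q q w}) -> {ae P, forall w, forall q, Q q w}.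
Proof.
move=> hQ.
have : {ae P, forall w, forall (m : nat) q,
    choice.unpickle m = Some q -> Q q w}.
  apply: ae_foralln => m; case: (choice.unpickle m) => [q|]; last exact: aeW.
  by apply: filterS (hQ q) => w qw q' [<-].
apply: filterS => w hw q; apply: (hw (choice.pickle q)).
by rewrite choice.pickleK.
Qed.

(** A value outside the essential range lies in an interval with rational
    endpoints charged with probability 0, and there are only countably many such
    intervals. *)
Lemma ae_essran : {ae P, forall w, forall n, essran (X 0%N) (X n w)}.
Proof.
pose V (q : rat * rat) : set R := `]ratr q.1, ratr q.2[%classic.
have mV q : measurable (V q) by exact: measurable_itv.
suff : {ae P, forall w, forall n q,
    distribution P (X 0%N) (V q) = 0%E -> ~ V q (X n w)}.
  apply: filterS => w hw n U oU Ux; rewrite lt0e measure_ge0 andbT.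
  apply/eqP => PU.
  have /nbhs_ballP[eps /= eps0 epsU] := open_nbhs_nbhs (conj oU Ux).
  have [q1] : exists q1 : rat, ratr q1 \in `]X n w - eps, X n w[.
    by apply: rat_in_itvoo; rewrite gtrBl.
  rewrite in_itv /= => /andP[q1l q1r].
  have [q2] : exists q2 : rat, ratr q2 \in `]X n w, X n w + eps[.
    by apply: rat_in_itvoo; rewrite ltrDl.
  rewrite in_itv /= => /andP[q2l q2r].
  apply: (hw n (q1, q2)); last by rewrite /V /= in_itv /= q1r q2l.
  apply/eqP; rewrite eq_le measure_ge0 andbT -PU.
  apply: le_measure; rewrite ?inE//.
    exact: open_measurable.
  move=> x; rewrite /V /= in_itv /= => /andP[xl xr]; apply: epsU.
  rewrite ball_itv /= in_itv /=.
  by rewrite (lt_trans q1l xl) (lt_trans xr q2r).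
apply: ae_foralln => n; apply: ae_forall_countable => q.
have [PV|PV] := eqVneq (distribution P (X 0%N) (V q)) 0%E; last first.
  by apply: aeW => w /eqP; rewrite (negPf PV).
exists (X n @^-1` V q); split.
- by rewrite -[X in measurable X]setTI; exact: measurable_funP.
- by have := X_ident n (mV q); rewrite PV.
- by move=> w /= nw; apply: contrapT => nVw; apply: nw.
Qed.

End RandomWeights.

(** * Norms of weighted shifts *)

Section Norms.
Context {R : realType} {H : hilbertSpace R}.

Lemma norm_sum_orthonormal (g : nat -> H) n (c : 'I_n -> R[i]) :
  (forall i j, inner H (g i) (g j) = (i == j)%:R) ->
  `|\sum_(i < n) c i *: g i| ^+ 2 = \sum_(i < n) `|c i| ^+ 2.
Proof.
move=> og; elim: n c => [|n IH] c.
  by rewrite !big_ord0 normr0 expr0n.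
rewrite !big_ord_recr /= pythagoras.
  rewrite IH normrZ exprMn; congr (_ + _).
  by rewrite hilbert_normE og eqxx mulr1.
rewrite innerZr.
have -> : inner H (\sum_(i < n) c (widen_ord (leqnSn n) i) *: g i) (g n) =
    \sum_(i < n) inner H (c (widen_ord (leqnSn n) i) *: g i) (g n).
  exact: linear_sumlz.
by rewrite big1 ?mulr0// => i _; rewrite innerZl og ltn_eqF ?mulr0.
Qed.

Lemma opnorm_shift_le1 (e : nat -> H) (b : nat -> R) (B : H -> H) :
  orthonormal_basis e -> bounded_operator B ->
  (forall n, B (e n) = (b n)%:C *: e n.+1) -> (forall n, 0 <= b n <= 1) ->
  (opnorm B <= 1)%E.
Proof.
move=> be hB Be b01; have [on _] := be.
apply/opnorm_leP => //.
have [C C0 hC] := bounded_operator_norm hB.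
apply: (@norm_le_dense _ _ _ (spanned e) _ C) => //.
- exact: spannedP.
- by move=> x y; exact: bounded_operatorB.
move=> _ [n [c ->]]; rewrite mul1r -(@ler_pXn2r _ 2) ?nnegrE//.
rewrite bounded_operator_sum//.
under eq_bigr do rewrite bounded_operatorZ// Be scalerA.
rewrite (norm_sum_orthonormal (g := fun i => e i.+1)); last first.
  by move=> i j; rewrite on eqSS.
rewrite norm_sum_orthonormal//; apply: ler_sum => i _.
rewrite ler_pXn2r ?nnegrE// normrM norm_complexR ler_piMr//.
have /andP[b0 b1] := b01 i.
by rewrite -lecR ger0_norm// lecR in b1 *.
Qed.

Lemma opnorm_shift_weight (f : nat -> H) (a : nat -> R) (A : H -> H) n :
  weighted_shift f a A -> (opnorm A <= 1)%E -> a n <= 1.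
Proof.
move=> [bf a0 _ hA Af] /(opnorm_leP hA ler01) /(_ (f n)).
rewrite Af normrZ !(orthonormal_norm _ bf) !mulr1 norm_complexR lecR.
by rewrite ger0_norm.
Qed.

End Norms.

(** Domination tested on the polynomial [x]. *)
Lemma dominated_opnorm {R : realType} {K H : hilbertSpace R}
    (A : K -> K) (B : H -> H) : dominated A B -> (opnorm A <= opnorm B)%E.
Proof.
have evalX (L : hilbertSpace R) (C : L -> L) :
    ncpoly_eval (mkmalgU (fmu ord0) 1) C (adjoint C) = C.
  apply/funext => x; rewrite /ncpoly_eval msuppU1 big_seq_fset1 mcoeffUU.
  by rewrite scale1r fmuE.
by move=> /(_ (mkmalgU (fmu ord0) 1)); rewrite !evalX.
Qed.

(** * The main result *)

Lemma approximate_occurrences {R : realType} (x t : nat -> R) :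
  (forall n, exists k, forall i, (i <= n)%N ->
    `|x (k + i)%N - t i| < n.+1%:R^-1) ->
  exists k : nat -> nat, forall i,
    (fun m => x (k m + i)%N - t i) @ \oo --> (0 : R).
Proof.
move=> /choice[k hk]; exists k => i; apply/cvgr0Pnorm_lt => eps eps0.
have small : \forall m \near \oo, m.+1%:R^-1 < eps.
  exact: near_infty_natSinv_lt (PosNum eps0).
near=> m; apply: (@lt_trans _ _ m.+1%:R^-1); last by near: m.
by apply: hk; near: m; exact: nbhs_infty_ge.
Unshelve. all: by end_near. Qed.

Theorem corollary1p3 (R : realType) (d : measure_display)
    (Omega : measurableType d) (P : probability Omega R)
    (H : hilbertSpace R) (e : nat -> H)
    (X : nat -> {RV P >-> R})
    (X_ge0 : forall n w, 0 <= X n w)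
    (X_bounded : forall n, exists M : R, forall w, X n w <= M)
    (X_indep : mutually_independent X)
    (X_ident : identically_distributed X)
    (T : Omega -> H -> H) (T_shift : random_weighted_shift e X T)
    (X_essran : essran (X 0%N) = `[0, 1]%classic)
    (K : hilbertSpace R) (f : nat -> K) (a : nat -> R)
    (A : K -> K) (A_shift : weighted_shift f a A) :
  {ae P, forall w, dominated A (T w)} <-> (opnorm A <= 1)%E.
Proof.
have [be bT T_e] := T_shift; split=> [domAT|A1].
  (* The conclusion does not depend on the sample point, so one good point is
     enough. *)
  have P0 : ~ P.-negligible [set: Omega].
    move/negligibleP => /(_ measurableT) PT0.
    have /eqP := etrans (esym PT0) (probability_setT P).
    by rewrite eqe eq_sym oner_eq0.
  have : {ae P, forall w, (opnorm A <= 1)%E}.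
    apply: filterS3 domAT T_e (ae_essran X_ident) => w domw Tw Xw.
    apply: (le_trans (dominated_opnorm domw)).
    apply: (opnorm_shift_le1 be (bT w) Tw) => n.
    by have := Xw n; rewrite X_essran /= in_itv.
  move=> aeA; apply: contrapT => nA; apply: P0.
  by apply: negligibleS aeA => w _.
have [bf a0 _ bA A_f] := A_shift.
(* The weights of [A], preceded by the weight 0 that imitates the left end. *)
pose t i := if i is j.+1 then a j else 0.
have t_essran i : essran (X 0%N) (t i).
  rewrite X_essran /= in_itv /=.
  case: i => [|i] /=; first by rewrite lexx ler01.
  by rewrite a0 (opnorm_shift_weight i A_shift A1).
have : {ae P, forall w n, exists k, forall i, (i <= n)%N ->
    `|X (k + i)%N w - t i| < n.+1%:R^-1}.
  by apply: ae_foralln => n; apply: ae_pattern => //; rewrite invr_gt0.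
apply: filterS2 T_e => w Tw.
move=> /(@approximate_occurrences _ (fun n => X n w)) [k hk].
apply: (dominated_of_copies (k := k) bf be bA (bT w) A_f Tw) => [|i].
  by have := hk 0%N; under eq_fun do rewrite subr0 addn0.
by have := hk i.+1; under eq_fun do rewrite addnS.
Qed.
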